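(* Let $N\ge1$, $\delta>0$, $\alpha>0$. Suppose each $c_n:\mathbb{R}\to\mathbb{R}$ ($n=1,\dots,N$) is continuous, satisfies $c_n(s)=0$ for $s\le 0$, and is convex and strictly increasing on $[0,\infty)$. Suppose the social cost minimization problem has an optimal solution $(\mathbf{s}^*,y^* )$ with $y^*>0$, with corresponding socially optimal price $p^*$. Let $(\mathbf{b}^t,p^t,y^t)$ be the price-taking market equilibrium. Then the operator's cost with price-taking tenants is at most that in the socially optimal case, and moreover $$\mathrm{cost}_o(p^*,y^* )-\frac{\alpha\delta}{N}\ \le\ \mathrm{cost}_o(p^t,y^t)\ \le\ \mathrm{cost}_o(p^*,y^* ).$$
   Context: There are $N$ tenants; $\delta$ is the total energy reduction target; $y$ is the amount of on-site generation, with unit cost $\alpha$. The operator's cost is $\mathrm{cost}_o(p,y)=p(\delta-y)+\alpha y$. The social cost minimization problem is $$\min\ \alpha y+\sum_{i=1}^N c_i(s_i)\quad\text{s.t.}\quad y+\sum_{i=1}^N s_i=\delta,\ s_i\ge0,\ y\ge0;$$ the socially optimal price $p^*$ is the Lagrange multiplier of the constraint $y+\sum_i s_i=\delta$. Supply function: $S(b_n,p)=\delta-\frac{b_n}{p}$ for bid $b_n\ge0$ and price $p>0$. Clearing price: $p(\mathbf{b},y)=\frac{\sum_n b_n}{(N-1)\delta+y}$ (conventions $0/0=0$, $x/0=+\infty$ for $x>0$). Payoff of a price-taking tenant: $P_n(b_n;p)=p\delta-b_n-c_n\!\left(\delta-\frac{b_n}{p}\right)$. A price-taking market equilibrium is a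 triple $(\mathbf{b},p,y)$ with $\mathbf b\ge 0$, $p>0$ such that $P_n(b_n;p)\ge P_n(\bar b_n;p)$ for all $\bar b_n\ge0$ and all $n$; $p=p(\mathbf{b},y)$; and $y\in\arg\min_{0\le y'\le\delta}(\delta-y')p(\mathbf{b},y')+\alpha y'$. *)

(* Defs.v *)
From HB Require Import structures.
From mathcomp Require Import all_boot all_order all_algebra.
From mathcomp Require Import all_classical all_reals all_analysis.

Set Implicit Arguments.
Unset Strict Implicit.
Unset Printing Implicit Defensive.

Import Order.TTheory GRing.Theory Num.Theory.
Import numFieldNormedType.Exports.

Local Open Scope classical_set_scope.
Local Open Scope ring_scope.

Definition argmin (T : Type) (d : Order.disp_t) (V : porderType d)
    (A : set T) (f : T -> V) : set T :=
  [set x | A x /\ forall x', A x' -> (f x <= f x')%O].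

Definition tenant_cost (R : realType) (c : R -> R) : Prop :=
  [/\ continuous c,
      forall s, s <= 0 -> c s = 0,
      convex_function (E := R^o) [set` `[0, +oo[%R] c &
      {in `[0, +oo[%R &, {homo c : s s' / s < s'}}].

Definition operator_cost (R : realType) (delta alpha p y : R) : R :=
  p * (delta - y) + alpha * y.

(* A pair (s, y) collects the tenants' reductions and the on-site generation. *)
Definition social_cost (R : realType) (N : nat) (alpha : R)
    (c : 'I_N -> R -> R) (sy : ('I_N -> R) * R) : R :=
  alpha * sy.2 + \sum_(i < N) c i (sy.1 i).

Definition social_nonneg (R : realType) (N : nat) : set (('I_N -> R) * R) :=
  [set sy | (forall i, 0 <= sy.1 i) /\ 0 <= sy.2].

Definition social_feasible (R : realType) (N : nat) (delta : R) :
    set (('I_N -> R) * R) :=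
  @social_nonneg R N `&` [set sy | sy.2 + \sum_(i < N) sy.1 i = delta].

Definition social_optimum (R : realType) (N : nat) (delta alpha : R)
    (c : 'I_N -> R -> R) : set (('I_N -> R) * R) :=
  argmin (@social_feasible R N delta) (social_cost alpha c).

Definition lagrangian (R : realType) (N : nat) (delta alpha : R)
    (c : 'I_N -> R -> R) (p : R) (sy : ('I_N -> R) * R) : R :=
  social_cost alpha c sy + p * (delta - (sy.2 + \sum_(i < N) sy.1 i)).

(* Only the balance constraint is dualized, the sign constraints stay in the
   domain; since the c_i need not be differentiable, stationarity is expressed
   as minimality of the Lagrangian over that domain. *)
Definition socially_optimal_price (R : realType) (N : nat) (delta alpha : R)
    (c : 'I_N -> R -> R) (sy : ('I_N -> R) * R) (p : R) : Prop :=
  argmin (@social_nonneg R N) (lagrangian delta alpha c p) sy.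

Definition supply (R : realType) (delta b p : R) : R := delta - b / p.

Definition payoff (R : realType) (delta : R) (c : R -> R) (b p : R) : R :=
  p * delta - b - c (supply delta b p).

(* In \bar R one has 0^-1 = +oo and 0 * +oo = 0, so that 0 / 0 = 0 and
   x / 0 = +oo for x > 0. The denominator vanishes only if N = 1 and y = 0. *)
Definition clearing_price (R : realType) (N : nat) (delta : R)
    (b : 'I_N -> R) (y : R) : \bar R :=
  ((\sum_(n < N) b n)%:E / ((N%:R - 1) * delta + y)%:E)%E.

(* operator_cost at the clearing price, which may be infinite. *)
Definition operator_market_cost (R : realType) (N : nat) (delta alpha : R)
    (b : 'I_N -> R) (y : R) : \bar R :=
  ((delta - y)%:E * clearing_price delta b y + (alpha * y)%:E)%E.

Definition price_taking_equilibrium (R : realType) (N : nat) (delta alpha : R)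
    (c : 'I_N -> R -> R) (b : 'I_N -> R) (p y : R) : Prop :=
  [/\ (forall n, 0 <= b n) /\ 0 < p,
      forall n (b' : R), 0 <= b' ->
        payoff delta (c n) b' p <= payoff delta (c n) (b n) p,
      p%:E = clearing_price delta b y &
      argmin [set` `[0, delta]%R] (operator_market_cost delta alpha b) y].

(* Main.v *)
Require Import Defs.
From HB Require Import structures.
From mathcomp Require Import all_boot all_order all_algebra.
From mathcomp Require Import all_classical all_reals all_analysis.
From mathcomp Require Import ring lra.

(** Since [ystar > 0], the multiplier is [alpha], so the socially optimal
    operator cost is [alpha * delta]; choosing [y = delta] attains it in the
    market, which is the upper bound. If [pt >= alpha] the lower bound is
    immediate. If [pt < alpha], supplies are monotone in the price, whence
    [yt >= ystar > 0], and the operator's optimality against smaller [y] gives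
    [alpha * u <= N * delta * pt] with [u = (N - 1) * delta + yt]. Then
    [(alpha - pt) * (delta - yt) <= alpha * (delta - yt)^2 / (N * delta)]. *)

Set Implicit Arguments.
Unset Strict Implicit.
Unset Printing Implicit Defensive.

Import Order.TTheory GRing.Theory Num.Theory.
Import numFieldNormedType.Exports.

Local Open Scope ring_scope.

(** The Lagrangian is affine in the generation with slope [alpha - p]; being minimal at [y > 0], it
    can be tested on both sides, at [0] and at [2 * y]. *)
Lemma socially_optimal_price_eq (R : realType) (N : nat) (delta alpha : R)
    (c : 'I_N -> R -> R) (s : 'I_N -> R) (y p : R) :
  0 < y -> socially_optimal_price delta alpha c (s, y) p -> p = alpha.
Proof.
move=> y0 [[/= s0 _] hmin].
have h0 : lagrangian delta alpha c p (s, y) <= lagrangian delta alpha c p (s, 0).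
  by apply: hmin; split.
have h2 : lagrangian delta alpha c p (s, y) <=
    lagrangian delta alpha c p (s, 2 * y).
  by apply: hmin; split => //=; lra.
move: h0 h2; rewrite /lagrangian /social_cost /= => h0 h2.
have : (alpha - p) * y = 0 by lra.
by move/eqP; rewrite mulf_eq0 (gt_eqF y0) orbF => /eqP ?; lra.
Qed.

Lemma clearing_price_fin (R : realType) (N : nat) (delta : R)
    (b : 'I_N -> R) (y : R) :
  0 < (N%:R - 1) * delta + y ->
  clearing_price delta b y =
    ((\sum_(n < N) b n) / ((N%:R - 1) * delta + y))%:E.
Proof. by move=> u0; rewrite /clearing_price inver gt_eqF. Qed.

(** With a zero denominator the price would be [0] or [+oo], and neither is a positive real. *)
Lemma fin_clearing_price_gt0 (R : realType) (N : nat) (delta : R)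
    (b : 'I_N -> R) (p y : R) :
  0 <= (N%:R - 1) * delta + y -> (forall n, 0 <= b n) -> 0 < p ->
  p%:E = clearing_price delta b y -> 0 < (N%:R - 1) * delta + y.
Proof.
move=> u0 b0 p0; rewrite lt0r u0 andbT /clearing_price inver.
case: eqP => // _.
have : 0 <= \sum_(n < N) b n by apply: sumr_ge0.
rewrite le_eqVlt => /orP[/eqP <-|B0].
  by rewrite mul0e => -[p_eq0]; move: p0; rewrite p_eq0 ltxx.
by rewrite gt0_muley ?lte_fin.
Qed.

(** A negative supply saves no cost but loses revenue, so the bid [p * delta], which supplies
    nothing, would pay strictly more. *)
Lemma supply_ge0 (R : realType) (delta b p : R) (c : R -> R) :
  0 <= delta -> 0 < p -> (forall s, s <= 0 -> c s = 0) ->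
  (forall b', 0 <= b' -> payoff delta c b' p <= payoff delta c b p) ->
  0 <= supply delta b p.
Proof.
move=> d0 p0 c0 hb; rewrite leNgt; apply/negP => s_lt0.
have := hb (p * delta) (mulr_ge0 (ltW p0) d0).
have pE : supply delta (p * delta) p = 0.
  by rewrite /supply; field; exact: lt0r_neq0.
rewrite /payoff pE !c0 // ?(ltW s_lt0) //.
have bE : b = p * (delta - supply delta b p).
  by rewrite /supply; field; exact: lt0r_neq0.
have : p * supply delta b p < 0 by rewrite pmulr_rlt0.
lra.
Qed.

(* Revealed preference: adding the optimality conditions at the two prices
   leaves [(alpha - p) * (\sum sstar - \sum st) >= 0]. *)
Lemma total_supply_le (R : realType) (N : nat) (delta alpha p ystar : R)
    (c : 'I_N -> R -> R) (sstar b : 'I_N -> R) :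
  0 <= delta -> 0 < p -> p < alpha ->
  (forall n s, s <= 0 -> c n s = 0) ->
  (forall n, sstar n <= delta) ->
  socially_optimal_price delta alpha c (sstar, ystar) alpha ->
  (forall n b', 0 <= b' ->
     payoff delta (c n) b' p <= payoff delta (c n) (b n) p) ->
  \sum_(n < N) supply delta (b n) p <= \sum_(n < N) sstar n.
Proof.
move=> d0 p0 pa c0 sd [[/= _ y0] hmin] hb.
pose st n := supply delta (b n) p.
have st0 n : 0 <= st n by exact: supply_ge0 d0 p0 (c0 n) (hb n).
have := hmin (st, ystar) (conj st0 y0).
rewrite /lagrangian /social_cost /= => hL.
have hn n : p * sstar n - c n (sstar n) <= p * st n - c n (st n).
  (* This is the bid that makes the tenant supply exactly [sstar n] at price [p]. *)
  have b'0 : 0 <= p * (delta - sstar n).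
    by apply: mulr_ge0; [exact: ltW|rewrite subr_ge0].
  have := hb n _ b'0; rewrite /payoff.
  have -> : supply delta (p * (delta - sstar n)) p = sstar n.
    by rewrite /supply; field; exact: lt0r_neq0.
  have bE : b n = p * (delta - st n).
    by rewrite /st /supply; field; exact: lt0r_neq0.
  rewrite -/(st n); lra.
have hS : \sum_(n < N) (p * sstar n - c n (sstar n)) <=
       \sum_(n < N) (p * st n - c n (st n)) by apply: ler_sum.
rewrite !sumrB -!mulr_sumr in hS.
by rewrite -(ler_pM2l (_ : 0 < alpha - p)) ?subr_gt0 // -/st; lra.
Qed.

Lemma sum_supply (R : realType) (N : nat) (delta p : R) (b : 'I_N -> R) :
  \sum_(n < N) supply delta (b n) p = N%:R * delta - (\sum_(n < N) b n) / p.
Proof.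
by rewrite sumrB sumr_const card_ord mulr_suml -[delta *+ N]mulr_natl.
Qed.

(** With [B] the sum of the bids and [u] the price denominator, the cost is
    [N * delta * B / u - B + alpha * y]. As [y > 0] can be lowered, its derivative
    [alpha - N * delta * p / u] is nonpositive. *)
Lemma operator_first_order (R : realType) (N : nat) (delta alpha p y : R)
    (b : 'I_N -> R) :
  (1 <= N)%N -> 0 < delta -> 0 < alpha -> 0 < p -> 0 < y ->
  \sum_(n < N) b n = p * ((N%:R - 1) * delta + y) ->
  argmin [set` `[0, delta]%R] (operator_market_cost delta alpha b) y ->
  alpha * ((N%:R - 1) * delta + y) <= N%:R * delta * p.
Proof.
move=> N1 d0 a0 p0 y0 BE [/=]; rewrite in_itv /= => /andP[_ yd] hmin.
have D0 : 0 <= (N%:R - 1) * delta.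
  by apply: mulr_ge0; [rewrite subr_ge0 ler1n|exact: ltW].
set D := (N%:R - 1) * delta in BE D0 *.
have u0 : 0 < D + y by lra.
rewrite leNgt; apply/negP => hlt.
(* [t] is the value of [D + y] that would give equality. *)
pose t := N%:R * delta * p / alpha.
have tu : t < D + y by rewrite /t ltr_pdivrMr // [X in _ < X]mulrC.
have tE : N%:R * delta * p = alpha * t.
  by rewrite /t; field; exact: lt0r_neq0.
(* A midpoint keeps [y'] positive, below [y], and still with [t < D + y']; moving to it will be
   strictly cheaper. *)
pose y' := (Num.max (t - D) 0 + y) / 2.
have [m1 m2 m3] : [/\ t - D <= Num.max (t - D) 0, 0 <= Num.max (t - D) 0
    & Num.max (t - D) 0 < y].
  by split; rewrite ?le_max ?lexx ?orbT // gt_max y0 andbT; lra.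
have [y'0 y'y ty'] : [/\ 0 < y', y' < y & t < D + y'].
  by rewrite /y'; split; lra.
have u'0 : 0 < D + y' by lra.
have := hmin y'; rewrite /= in_itv /= => /(_ _)/wrap[].
  by apply/andP; split; lra.
rewrite /operator_market_cost !clearing_price_fin // BE -/D.
rewrite -!EFinM -!EFinD lee_fin.
have -> : p * (D + y) / (D + y) = p by field; exact: lt0r_neq0.
have -> : p * (D + y) / (D + y') = p + p * (y - y') / (D + y').
  by field; exact: lt0r_neq0.
(* The factor [N * delta] arises as [(D + y') + (delta - y')]. *)
have -> : (delta - y') * (p + p * (y - y') / (D + y')) =
  (delta - y) * p + (y - y') * (N%:R * delta * p) / (D + y').
  by rewrite /D in u'0 *; field; exact: lt0r_neq0.
rewrite tE => h.
have : (y - y') * (alpha * t) / (D + y') < (y - y') * alpha.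
  rewrite ltr_pdivrMr // -mulrA ltr_pM2l ?subr_gt0 //.
  by rewrite ltr_pM2l.
lra.
Qed.

Theorem theorem6 (R : realType) (N : nat) (delta alpha : R)
    (c : 'I_N -> R -> R)
    (sstar : 'I_N -> R) (ystar pstar : R)
    (bt : 'I_N -> R) (pt yt : R)
    (hN : (1 <= N)%N) (hdelta : 0 < delta) (halpha : 0 < alpha)
    (hc : forall n, tenant_cost (c n))
    (hopt : social_optimum delta alpha c (sstar, ystar))
    (hystar : 0 < ystar)
    (hpstar : socially_optimal_price delta alpha c (sstar, ystar) pstar)
    (heq : price_taking_equilibrium delta alpha c bt pt yt) :
  operator_cost delta alpha pstar ystar - alpha * delta / N%:R
    <= operator_cost delta alpha pt yt
  /\ operator_cost delta alpha pt yt <= operator_cost delta alpha pstar ystar.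
Proof.
have pE := socially_optimal_price_eq hystar hpstar; subst pstar.
have -> : operator_cost delta alpha alpha ystar = alpha * delta.
  by rewrite /operator_cost; ring.
case: heq => -[b0 p0] hb hp hy.
have [/= + ymin] := hy; rewrite in_itv /= => /andP[y0 yd].
have N1 : 1 <= N%:R :> R by rewrite ler1n.
have D0 : 0 <= (N%:R - 1) * delta.
  by apply: mulr_ge0; [rewrite subr_ge0|exact: ltW].
have u0 : 0 < (N%:R - 1) * delta + yt.
  by apply: fin_clearing_price_gt0 b0 p0 hp; exact: addr_ge0.
have BE : \sum_(n < N) bt n = pt * ((N%:R - 1) * delta + yt).
  move: hp; rewrite clearing_price_fin // => -[->].
  by field; exact: lt0r_neq0.
split; last first.
  have := ymin delta; rewrite /= in_itv /= lexx (ltW hdelta) => /(_ isT).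
  rewrite /operator_market_cost -hp subrr mul0e add0e.
  by rewrite -EFinM -EFinD lee_fin /operator_cost mulrC.
have NR0 : 0 < N%:R :> R by lra.
have q0 : 0 <= alpha * delta / N%:R.
  by apply: divr_ge0; [apply: mulr_ge0; exact: ltW|exact: ltW].
rewrite /operator_cost.
have [ap|pa] := leP alpha pt.
  have : 0 <= (pt - alpha) * (delta - yt) by apply: mulr_ge0; lra.
  lra.
have [[[/= s0 _] sy] _] := hopt; move: sy => /= sy.
have sd n : sstar n <= delta.
  have : sstar n <= \sum_(i < N) sstar i.
    by rewrite (bigD1 n) //= lerDl sumr_ge0.
  lra.
have c0 n s : s <= 0 -> c n s = 0 by case: (hc n) => _ h _ _; exact: h.
have := total_supply_le (ltW hdelta) p0 pa c0 sd hpstar hb.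
rewrite sum_supply BE.
have -> : pt * ((N%:R - 1) * delta + yt) / pt = (N%:R - 1) * delta + yt.
  by field; exact: lt0r_neq0.
move=> hS.
(* [hS] reads [delta - yt <= \sum sstar], which is [delta - ystar] by the balance constraint. *)
have yt0 : 0 < yt by lra.
have hF := operator_first_order hN hdelta halpha p0 yt0 BE hy.
(* Subtract [hF] from [alpha * N * delta], using [N * delta = (N - 1) * delta + delta]. *)
have h1 : N%:R * delta * (alpha - pt) <= alpha * (delta - yt) by lra.
have h2 : N%:R * delta * (alpha - pt) * (delta - yt) <=
    alpha * (delta - yt) * (delta - yt) by apply: ler_wpM2r => //; lra.
have h3 : alpha * (delta - yt) * (delta - yt) <= alpha * delta * delta.
  by rewrite -!mulrA ler_pM2l // ler_pM; lra.
suff : (alpha - pt) * (delta - yt) <= alpha * delta / N%:R by lra.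
rewrite ler_pdivlMr // -(ler_pM2r hdelta); lra.
Qed.
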